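(* Let $\mathbf{X}=[\mathbf{x}_1,\dots,\mathbf{x}_n]\in\mathbb{R}^{p\times n}$ be a fixed (deterministic) matrix with columns $\mathbf{x}_i$, let $1\le m\le p$, and let $\mathbf{R}_1,\dots,\mathbf{R}_n\in\mathbb{R}^{p\times m}$ be independent random sampling matrices, where the $m$ columns of each $\mathbf{R}_i$ are chosen uniformly at random without replacement from the set of all $p$ canonical basis vectors of $\mathbb{R}^p$. Let $\overline{\mathbf{x}}_n=\frac1n\sum_{i=1}^n\mathbf{x}_i$ and $$\widehat{\overline{\mathbf{x}}}_n=\frac{p}{m}\,\frac1n\sum_{i=1}^n\mathbf{R}_i\mathbf{R}_i^T\mathbf{x}_i .$$ Then $\mathbb{E}[\widehat{\overline{\mathbf{x}}}_n]=\overline{\mathbf{x}}_n$. Moreover, with $\tau(m,p)=\max\{\frac pm-1,\,1\}$, for every $t\ge 0$, with probability at least $1-\delta_1$, where $$\delta_1=2p\exp\left(\frac{-n t^2/2}{\left(\frac pm-1\right)\|\mathbf{X}\|_{\text{max-row}}^2/n+\tau(m,p)\,\|\mathbf{X}\|_{\max}\,t/3}\right),$$ we have $$\|\widehat{\overline{\mathbf{x}}}_n-\overline{\mathbf{x}}_n\|_\infty\le t .$$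
   Context: For a matrix $\mathbf{X}$: $\|\mathbf{X}\|_{\max}$ is the maximum absolute value of its entries, and $\|\mathbf{X}\|_{\text{max-row}}$ is the maximum $\ell_2$ norm of its rows. $\|\cdot\|_\infty$ is the maximum norm of a vector. The data are deterministic; the only randomness is in the sampling matrices. *)

(* Defs.v *)
From HB Require Import structures.
From mathcomp Require Import all_boot all_order all_algebra.
From mathcomp Require Import all_classical all_reals all_analysis.

Set Implicit Arguments.
Unset Strict Implicit.
Unset Printing Implicit Defensive.

Import Order.TTheory GRing.Theory Num.Theory.
Import numFieldNormedType.Exports.

Local Open Scope classical_set_scope.
Local Open Scope ring_scope.

(* p x m matrices with the Borel sigma-algebra of R^(p x m), i.e. the one
   generated by the entries; convertible to 'M[R]_(p, m). *)
Definition borelMx (R : realType) (p m : nat) :=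
  g_sigma_algebraType
    (\bigcup_(jk in [set: 'I_p * 'I_m])
       preimage_set_system [set: 'M[R]_(p, m)]
         (fun A : 'M[R]_(p, m) => A jk.1 jk.2) (@measurable _ R)).

Definition mutually_independent (R : realType) (I : finType)
    (d d' : measure_display) (T : measurableType d) (T' : measurableType d')
    (P : probability T R) (Y : I -> {RV P >-> T'}) : Prop :=
  forall (J : {set I}) (B : I -> set T'), (forall i, measurable (B i)) ->
    P (\bigcap_(i in [set` J]) (Y i @^-1` B i)) =
    (\prod_(i in J) P (Y i @^-1` B i))%E.

Definition sampling_mx (R : realType) (p m : nat)
    (s : {ffun 'I_m -> 'I_p}) : 'M[R]_(p, m) :=
  \matrix_(j, k) (j == s k)%:R.

Lemma col_sampling_mx (R : realType) (p m : nat)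
    (s : {ffun 'I_m -> 'I_p}) (k : 'I_m) :
  col k (sampling_mx R s) = delta_mx (s k) 0.
Proof. by apply/colP => j; rewrite !mxE eqxx andbT. Qed.

(* Drawing m of the p canonical basis vectors without replacement is drawing
   an injection s : 'I_m -> 'I_p (the ordered sample) uniformly. These atoms
   carry the total mass, so the condition determines the law of A. *)
Definition uniform_sampling (R : realType) (p m : nat) (d : measure_display)
    (T : measurableType d) (P : probability T R)
    (A : {RV P >-> borelMx R p m}) : Prop :=
  forall s : {ffun 'I_m -> 'I_p}, injective s ->
    P (A @^-1` [set sampling_mx R s]) =
    ((#|[pred f : {ffun 'I_m -> 'I_p} | injectiveb f]|%:R : R)^-1)%:E.

Definition sample_mean (R : realType) (p n : nat) (X : 'M[R]_(p, n)) : 'cV[R]_p :=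
  n%:R^-1 *: \sum_(i < n) col i X.

Definition sample_mean_estimator (R : realType) (p m n : nat)
    (X : 'M[R]_(p, n)) (S : 'I_n -> 'M[R]_(p, m)) : 'cV[R]_p :=
  (p%:R / m%:R) *: (n%:R^-1 *: \sum_(i < n) S i *m (S i)^T *m col i X).

Definition maxrow_norm (R : realType) (p n : nat) (X : 'M[R]_(p, n)) : R :=
  \big[Num.max/0]_(j < p) Num.sqrt (\sum_(i < n) X j i ^+ 2).

Definition tau (R : realType) (m p : nat) : R := Num.max (p%:R / m%:R - 1) 1.

(* mx_norm is the largest absolute value of the entries. For t > 0 the
   denominator vanishes only if X = 0, and then, since x / 0 = 0, delta1 is
   2 p instead of its limit 0. *)
Definition delta1 (R : realType) (p m n : nat) (X : 'M[R]_(p, n)) (t : R) : R :=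
  2 * p%:R *
  expR ((- (n%:R * t ^+ 2) / 2) /
        ((p%:R / m%:R - 1) * maxrow_norm X ^+ 2 / n%:R
         + tau R m p * mx_norm X * t / 3)).

(* Main.v *)
(* Almost surely every S i is the matrix of an injection 'I_m -> 'I_p, so both
   claims are finite sums over families of injections with uniform weight. For
   such a family the j-th error coordinate is the average over i of
   (p / m * b_i - 1) * X j i, where b_i, the indicator that the i-th injection
   hits j, has mean m / p because the m hits are spread evenly over the p
   coordinates. Each summand is centered, bounded by tau * |X|_max, and has
   variance (p / m - 1) * X j i ^ 2; Bernstein's inequality for both signs and
   a union bound over j give the tail estimate. *)
Require Import Defs.
From HB Require Import structures.
From mathcomp Require Import all_boot all_order all_algebra.
From mathcomp Require Import all_classical all_reals all_analysis.
From mathcomp Require Import perm measurable_realfun ring lra.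

Set Implicit Arguments.
Unset Strict Implicit.
Unset Printing Implicit Defensive.

Import Order.TTheory GRing.Theory Num.Theory.
Import numFieldNormedType.Exports.

Local Open Scope classical_set_scope.
Local Open Scope ring_scope.

(** * Exponential inequalities behind Bernstein's bound *)

Lemma MVT_everywhere (R : realType) (f df : R -> R) (a b : R) :
  (forall x : R, is_derive x 1 f (df x)) -> a <= b ->
  exists2 c, a <= c <= b & f b - f a = df c * (b - a).
Proof.
move=> fdf ab; have [|c + ->] := MVT_segment ab (fun x _ => fdf x).
  by apply: derivable_within_continuous => x _; exact: ex_derive.
by rewrite in_itv/= => cab; exists c.
Qed.

(** The derivative [expR z - (1 + z)] is nonnegative. As the remainder vanishes at 0, it has the
    sign of its argument, which settles the sign of [df] below. *)
Lemma nondecreasing_expRB_quadratic (R : realType) (x y : R) : x <= y ->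
  expR x - (1 + x + x ^+ 2 / 2) <= expR y - (1 + y + y ^+ 2 / 2).
Proof.
move=> xy; pose f z : R := expR z - (1 + z + z ^+ 2 / 2).
have df (z : R) : is_derive z 1 f (expR z - (1 + z)).
  by rewrite /f; apply: is_derive_eq; rewrite /GRing.scale/=; lra.
rewrite -/(f x) -/(f y) -subr_ge0.
have [c _ ->] := MVT_everywhere df xy.
by rewrite mulr_ge0 ?subr_ge0// expR_ge1Dx.
Qed.

(* Clearing the denominator 3 - u keeps the inequality valid for every u. *)
Lemma expR_le_bernstein (R : realType) (u : R) :
  expR u * (3 - u) <= 3 + 2 * u + u ^+ 2 / 2.
Proof.
(* After multiplication by [expR (- u)] the claim reads [3 <= f u]; [f] has its minimum 3 at 0,
   since [df] is a Taylor remainder times a positive factor. *)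
pose f x : R := (3 + 2 * x + x ^+ 2 / 2) * expR (- x) + x.
pose df x : R := (expR x - (1 + x + x ^+ 2 / 2)) * expR (- x).
have fdf (x : R) : is_derive x 1 f (df x).
  rewrite /f /df mulrBl -expRD subrr expR0; apply: is_derive_eq.
  by rewrite /GRing.scale/=; lra.
have f_ge3 : 3 <= f u.
  have f0 : f 0 = 3 by rewrite /f oppr0 expR0; lra.
  have q0 : expR 0 - (1 + 0 + 0 ^+ 2 / 2) = 0 :> R by rewrite expR0; lra.
  rewrite -f0; have [u0|/ltW u0] := leP 0 u.
    have [c /andP[c0 _] E] := MVT_everywhere fdf u0.
    rewrite -subr_ge0 E mulr_ge0 ?subr_ge0// mulr_ge0 ?expR_ge0//.
    by rewrite -[leLHS]q0 nondecreasing_expRB_quadratic.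
  have [c /andP[_ c0] E] := MVT_everywhere fdf u0.
  rewrite -subr_le0 E mulr_le0_ge0 ?subr_ge0//.
  rewrite mulr_le0_ge0 ?expR_ge0//.
  by rewrite -[leRHS]q0 nondecreasing_expRB_quadratic.
rewrite -(ler_pM2r (expR_gt0 (- u))) mulrAC -expRD subrr expR0 mul1r.
by move: f_ge3; rewrite /f; lra.
Qed.

(** Dividing [expR_le_bernstein] by [3 - u] gives exactly this bound with [u] in place of [L]; the
    factor [1 / (1 - u / 3)] increases with [u] below 3. *)
Lemma expR_le_quadratic (R : realType) (u L : R) : u <= L -> L < 3 ->
  expR u <= 1 + u + u ^+ 2 / 2 / (1 - L / 3).
Proof.
move=> uL L3; have u3 : 0 < 3 - u by lra.
have L3' : 0 < 1 - L / 3 by lra.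
have u3' : 0 < 1 - u / 3 by lra.
apply: (@le_trans _ _ (1 + u + u ^+ 2 / 2 / (1 - u / 3))).
  rewrite -(ler_pM2r u3); apply: (le_trans (expR_le_bernstein u)).
  rewrite le_eqVlt; apply/orP; left; apply/eqP.
  by field; rewrite gt_eqF.
rewrite lerD2l ler_wpM2l ?divr_ge0 ?sqr_ge0// lef_pV2 ?posrE//; lra.
Qed.

(** * Bernstein's inequality for product weights on a finite set *)

Section product_weight.
Variables (R : realType) (I O : finType) (w : O -> R).
Hypotheses (w_ge0 : forall o, 0 <= w o) (w_sum1 : \sum_o w o = 1).

(** The value [g (s i)] is absorbed into the [i]-th factor; once the product is distributed over the
    sums, every other factor sums to 1. *)
Lemma product_weight_marginal (g : O -> R) (i : I) :
  \sum_(s : {ffun I -> O}) (\prod_k w (s k)) * g (s i) = \sum_o w o * g o.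
Proof.
transitivity (\prod_k \sum_o w o * (if k == i then g o else 1)).
  rewrite bigA_distr_bigA; apply: eq_bigr => s _.
  by rewrite big_split/= -big_mkcond big_pred1_eq.
rewrite (bigD1 i)//= [X in _ * X]big1 ?mulr1 ?eqxx// => k /negPf ki.
by under eq_bigr do rewrite ki mulr1.
Qed.

(** Averaging [expR_le_quadratic] at [u = l * y o] and [L = l * M] leaves no linear term because [y]
    is centered; [1 + x <= expR x] concludes. *)
Lemma mgf_le_bernstein (y : O -> R) (M l : R) :
  \sum_o w o * y o = 0 -> (forall o, y o <= M) -> 0 <= l -> l * M < 3 ->
  \sum_o w o * expR (l * y o) <=
  expR (l ^+ 2 * (\sum_o w o * y o ^+ 2) / 2 / (1 - l * M / 3)).
Proof.
move=> y0 yM l0 lM.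
apply: le_trans (expR_ge1Dx _).
apply: (@le_trans _ _ (\sum_o (w o + l * (w o * y o) +
    l ^+ 2 / 2 / (1 - l * M / 3) * (w o * y o ^+ 2)))).
  apply: ler_sum => o _.
  apply: (@le_trans _ _ (w o *
      (1 + l * y o + (l * y o) ^+ 2 / 2 / (1 - l * M / 3)))).
    by rewrite ler_wpM2l// expR_le_quadratic// ler_wpM2l.
  by rewrite exprMn; lra.
rewrite !big_split/= w_sum1 -!mulr_sumr y0 mulr0 addr0 lerD2l; lra.
Qed.

(* For V = 0 the optimal parameter l below reaches 3 / M, where the bound on
   the moment generating function breaks down; then Y vanishes w-a.e. *)
Lemma bernstein_product_weight (Y : I -> O -> R) (M V a : R) :
  (forall i, \sum_o w o * Y i o = 0) -> (forall i o, Y i o <= M) ->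
  \sum_i \sum_o w o * Y i o ^+ 2 <= V -> 0 <= M -> 0 < a ->
  \sum_(s : {ffun I -> O} | a < \sum_i Y i (s i)) \prod_i w (s i) <=
  expR (- (a ^+ 2 / 2) / (V + M * a / 3)).
Proof.
move=> Y0 YM YV M0 a0.
have vi_ge0 i : 0 <= \sum_o w o * Y i o ^+ 2.
  by apply: sumr_ge0 => o _; rewrite mulr_ge0 ?sqr_ge0.
have : 0 <= V by apply: le_trans YV; apply: sumr_ge0.
rewrite le_eqVlt => /predU1P[V0|V_gt0].
  rewrite big1 ?expR_ge0// => s /(lt_trans a0) sumY.
  have wY i o : w o * Y i o ^+ 2 = 0.
    have /psumr_eq0P : \sum_i \sum_o w o * Y i o ^+ 2 = 0.
      by apply/le_anti; rewrite sumr_ge0// andbT [leRHS]V0.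
    move=> /(_ (fun i _ => vi_ge0 i) i isT) /psumr_eq0P; apply => // o' _.
    by rewrite mulr_ge0 ?sqr_ge0.
  have [i Yi] : exists i, Y i (s i) != 0.
    apply/existsP; apply: contraLR sumY; rewrite negb_exists => /forallP Ys0.
    by rewrite big1 ?ltxx// => i _; apply/eqP; rewrite -[_ == _]negbK Ys0.
  move/eqP: (wY i (s i)); rewrite mulf_eq0 expf_eq0/= (negPf Yi) orbF => /eqP ws.
  by rewrite (bigD1 i)//= ws mul0r.
have D0 : 0 < V + M * a / 3 by rewrite ltr_pwDl// !mulr_ge0// ltW.
(* With this value [1 - l * M / 3] is [V / (V + M * a / 3)], so the quadratic term of the exponent
   is [l * a / 2] and the whole exponent [- (l * a) / 2]. *)
pose l := a / (V + M * a / 3).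
have l0 : 0 <= l by rewrite divr_ge0 ?ltW.
have lM : 1 - l * M / 3 = V / (V + M * a / 3).
  by rewrite /l; field; rewrite gt_eqF//; lra.
have lM3 : l * M < 3.
  have : 0 < 1 - l * M / 3 by rewrite lM divr_gt0.
  lra.
(* Chernoff's step: on the event, 1 is at most the exponential of [l] times the excess of the sum
   over [a]; elsewhere the new term is nonnegative. *)
apply: (@le_trans _ _ (\sum_(s : {ffun I -> O})
    expR (- (l * a)) * \prod_i (w (s i) * expR (l * Y i (s i))))).
  rewrite big_mkcond; apply: ler_sum => s _; rewrite big_split/= -expR_sum.
  rewrite -mulr_sumr mulrCA -expRD; case: ifPn => [aY|_].
    rewrite -[leLHS]mulr1 ler_wpM2l ?prodr_ge0// -[leLHS]expR0 ler_expR.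
    by rewrite addrC subr_ge0 ler_wpM2l// ltW.
  by rewrite mulr_ge0 ?prodr_ge0 ?expR_ge0.
rewrite -mulr_sumr.
(* Under a product weight the exponential moment of the sum factors into those of its terms. *)
rewrite -(bigA_distr_bigA (fun i o => w o * expR (l * Y i o))).
apply: (@le_trans _ _ (expR (- (l * a)) *
    \prod_i expR (l ^+ 2 * (\sum_o w o * Y i o ^+ 2) / 2 / (1 - l * M / 3)))).
  rewrite ler_wpM2l ?expR_ge0// ler_prod// => i _.
  rewrite sumr_ge0/=; first exact: mgf_le_bernstein.
  by move=> o _; rewrite mulr_ge0 ?expR_ge0.
rewrite -expR_sum -expRD ler_expR lM -!mulr_suml -mulr_sumr.
apply: (@le_trans _ _ (- (l * a) +
    l ^+ 2 * V / 2 / (V / (V + M * a / 3)))).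
  rewrite lerD2l ler_wpM2r ?invr_ge0 ?divr_ge0 ?(ltW D0) ?(ltW V_gt0)//.
  by rewrite ler_wpM2r ?invr_ge0// ler_wpM2l ?sqr_ge0.
rewrite le_eqVlt; apply/orP; left; apply/eqP.
by rewrite /l; field; rewrite !gt_eqF//; lra.
Qed.

End product_weight.

(** * Sampling matrices and the coordinates they hit *)

Lemma sampling_mx_inj (R : realType) (p m : nat) : injective (@sampling_mx R p m).
Proof.
move=> s s' ss'; apply/ffunP => k; move/matrixP: ss' => /(_ (s k) k).
by rewrite !mxE eqxx => /esym/eqP; rewrite pnatr_eq1 eqb1 => /eqP.
Qed.

Section hits.
Variables (R : realType) (p m : nat).
Implicit Types (s : {ffun 'I_m -> 'I_p}) (j : 'I_p).

(** The [j]-th diagonal entry of the sampling matrix times its transpose. The form of a sum over [k]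
    lets totals be computed by exchanging sums. *)
Definition hits s j : R := \sum_k (j == s k)%:R.

Lemma mul_sampling_mx_col n (X : 'M[R]_(p, n)) s j i :
  (sampling_mx R s *m (sampling_mx R s)^T *m col i X) j 0 = hits s j * X j i.
Proof.
rewrite -mulmxA mxE mulr_suml; apply: eq_bigr => k _; rewrite !mxE.
have [->|_] := eqVneq j (s k); last by rewrite !mul0r.
rewrite !mul1r (bigD1 (s k))//= !mxE eqxx mul1r big1 ?addr0// => l lsk.
by rewrite !mxE (negPf lsk) mul0r.
Qed.

Lemma hits_01 s j : injective s -> hits s j = 0 \/ hits s j = 1.
Proof.
move=> s_inj; have [k /eqP jk|jk] := pickP (fun k => j == s k).
  right; rewrite /hits (bigD1 k)//= -jk eqxx big1 ?addr0// => l lk.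
  by rewrite jk (inj_eq s_inj) eq_sym (negPf lk).
by left; rewrite /hits big1// => k _; rewrite jk.
Qed.

Lemma sum_hits s : \sum_j hits s j = m%:R.
Proof.
rewrite exchange_big/= -[m in RHS]card_ord -sumr_const; apply: eq_bigr => k _.
rewrite (bigD1 (s k))//= eqxx big1 ?addr0// => j.
by move=> /negPf ->.
Qed.

(** Composition with the transposition of [j] and [j'] is an involution that preserves injectivity
    and swaps the hits of the two coordinates. *)
Lemma sum_injective_hits_sym j j' :
  \sum_(s : {ffun 'I_m -> 'I_p} | injectiveb s) hits s j =
  \sum_(s : {ffun 'I_m -> 'I_p} | injectiveb s) hits s j'.
Proof.
pose h s := [ffun k => tperm j j' (s k)] : {ffun 'I_m -> 'I_p}.
have hK : cancel h h by move=> s; apply/ffunP => k; rewrite !ffunE tpermK.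
rewrite (reindex h)/=; last by exists h => s _; exact: hK.
apply: eq_big => s.
  apply/injectiveP/injectiveP => inj_s k l.
    by move=> kl; apply: inj_s; rewrite !ffunE kl.
  by rewrite !ffunE => /perm_inj/inj_s.
move=> _; apply: eq_bigr => k _; rewrite !ffunE.
by rewrite -(inj_eq (@perm_inj _ (tperm j j'))) tpermK tpermL.
Qed.

End hits.

(** * Moments and tail bounds for independent uniform injections *)

Notation injection m p := {s : {ffun 'I_m -> 'I_p} | injectiveb s}.

Section uniform_injection.
Variables (R : realType) (p m : nat).
Hypotheses (m_gt0 : (0 < m)%N) (m_le_p : (m <= p)%N).
Notation N := (#|{: injection m p}|%:R : R).

Lemma card_injection_gt0 : (0 < #|{: injection m p}|)%N.
Proof.
apply/card_gt0P; have f_inj : injectiveb [ffun k => widen_ord m_le_p k].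
  by apply/injectiveP => k l; rewrite !ffunE => /(congr1 val)/= /val_inj.
by exists (exist (fun s : {ffun 'I_m -> 'I_p} => is_true (injectiveb s)) _ f_inj).
Qed.

(** By symmetry all [p] coordinates have the same mean, and these means add up to [m]. *)
Lemma mean_hits (j : 'I_p) :
  \sum_(s : injection m p) N^-1 * hits R (val s) j = m%:R / p%:R.
Proof.
have p0 : p%:R != 0 :> R by rewrite pnatr_eq0 -lt0n (leq_trans m_gt0).
have N0 : N != 0 by rewrite pnatr_eq0 -lt0n card_injection_gt0.
apply: (mulIf p0); apply: (mulfI N0); rewrite divfK// -mulr_sumr.
rewrite !mulrA divff// mul1r.
transitivity (\sum_(j' < p) \sum_(s : injection m p) hits R (val s) j').
  rewrite mulr_natr -[X in _ *+ X]card_ord -sumr_const; apply: eq_bigr => j' _.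
  pose P := [pred s : {ffun 'I_m -> 'I_p} | injectiveb s].
  rewrite -(big_sub P (fun s => hits R s j)).
  rewrite -(big_sub P (fun s => hits R s j')).
  exact: sum_injective_hits_sym.
rewrite exchange_big/= mulr_natl -sumr_const; apply: eq_bigr => s _.
exact: sum_hits.
Qed.

(** The coefficient of [X j i] in [n] times the [j]-th error coordinate, when the [i]-th sample is
    [s]. *)
Definition centered_hits (j : 'I_p) (s : injection m p) : R :=
  p%:R / m%:R * hits R (val s) j - 1.

Lemma sum_weight : \sum_(s : injection m p) N^-1 = 1.
Proof.
rewrite sumr_const -[LHS]mulr_natr mulVf//.
by rewrite pnatr_eq0 -lt0n card_injection_gt0.
Qed.

Lemma sum_product_weight n :
  \sum_(s : {ffun 'I_n -> injection m p}) \prod_(i < n) N^-1 = 1.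
Proof.
rewrite -(bigA_distr_bigA (fun (i : 'I_n) (s : injection m p) => N^-1)).
by rewrite big1// => i _; exact: sum_weight.
Qed.

Lemma mean_centered_hits (j : 'I_p) :
  \sum_(s : injection m p) N^-1 * centered_hits j s = 0.
Proof.
under eq_bigr do rewrite mulrBr mulr1 mulrCA.
rewrite sumrB sum_weight -mulr_sumr mean_hits mulf_div.
rewrite [X in X / _]mulrC divff ?subrr//.
by rewrite mulf_neq0// pnatr_eq0 -lt0n// (leq_trans m_gt0).
Qed.

(** On injections [hits] is 0 or 1, so the square is affine in [hits] and its mean follows from
    [mean_hits]. *)
Lemma variance_centered_hits (j : 'I_p) :
  \sum_(s : injection m p) N^-1 * centered_hits j s ^+ 2 = p%:R / m%:R - 1.
Proof.
have p0 : p%:R != 0 :> R by rewrite pnatr_eq0 -lt0n (leq_trans m_gt0).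
have m0 : m%:R != 0 :> R by rewrite pnatr_eq0 -lt0n.
have E s : centered_hits j s ^+ 2 =
    (p%:R / m%:R) * (p%:R / m%:R - 2) * hits R (val s) j + 1.
  rewrite /centered_hits.
  by have [->|->] := hits_01 R j (injectiveP _ (valP s)); ring.
under eq_bigr do rewrite E mulrDr mulr1 mulrCA.
rewrite big_split/= sum_weight -mulr_sumr mean_hits.
by field; rewrite p0 m0.
Qed.

(** The two possible values, [- 1] and [p / m - 1], account for the two arguments of the maximum in
    [tau]. *)
Lemma norm_centered_hits_le (j : 'I_p) s : `|centered_hits j s| <= tau R m p.
Proof.
have pm : 1 <= p%:R / m%:R :> R by rewrite ler_pdivlMr ?ltr0n// mul1r ler_nat.
rewrite /centered_hits /tau le_max.
have [->|->] := hits_01 R j (injectiveP _ (valP s)).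
  by rewrite mulr0 sub0r normrN normr1 lexx orbT.
by rewrite mulr1 ger0_norm ?lexx// subr_ge0.
Qed.

Lemma sum_row_le_maxrow n (X : 'M[R]_(p, n)) j :
  \sum_i X j i ^+ 2 <= maxrow_norm X ^+ 2.
Proof.
have S0 : 0 <= \sum_i X j i ^+ 2 by apply: sumr_ge0 => i _; exact: sqr_ge0.
rewrite -[leLHS]sqr_sqrtr// ler_pXn2r ?nnegrE ?sqrtr_ge0//.
  exact: (le_bigmax _ (fun j => Num.sqrt (\sum_i X j i ^+ 2))).
exact: bigmax_ge_id.
Qed.

Lemma norm_entry_le_mx_norm n (X : 'M[R]_(p, n)) j i : `|X j i| <= mx_norm X.
Proof.
rewrite mx_normrE.
exact: (le_bigmax_cond _ (fun x => `|X x.1 x.2|) (j := (j, i))).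
Qed.

(** The sign [(-1) ^+ e] lets one statement cover both tails. Bernstein's inequality is applied to
    the sum before division by [n], hence at threshold [n * t]. *)
Lemma coordinate_tail n (X : 'M[R]_(p, n)) (t : R) (j : 'I_p) (e : bool) :
  (0 < n)%N -> 0 < t ->
  \sum_(s : {ffun 'I_n -> injection m p} |
      t < n%:R^-1 * \sum_i (-1) ^+ e * centered_hits j (s i) * X j i)
    \prod_(i < n) N^-1 <=
  expR ((- (n%:R * t ^+ 2) / 2) /
        ((p%:R / m%:R - 1) * maxrow_norm X ^+ 2 / n%:R
         + tau R m p * mx_norm X * t / 3)).
Proof.
move=> n_gt0 t0; have n0 : 0 < n%:R :> R by rewrite ltr0n.
have tau0 : 0 <= tau R m p by rewrite le_max ler01 orbT.
have X0 : 0 <= mx_norm X by rewrite mx_normrE bigmax_ge_id.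
have pm : 1 <= p%:R / m%:R :> R by rewrite ler_pdivlMr ?ltr0n// mul1r ler_nat.
pose Y i s := (-1) ^+ e * centered_hits j s * X j i.
have YE i s : Y i s ^+ 2 = X j i ^+ 2 * centered_hits j s ^+ 2.
  by rewrite /Y !exprMn sqrr_sign mul1r mulrC.
have YM i s : Y i s <= tau R m p * mx_norm X.
  rewrite (le_trans (ler_norm _))// !normrM normr_sign mul1r.
  by rewrite ler_pM ?norm_centered_hits_le ?norm_entry_le_mx_norm.
have Y0 i : \sum_(s : injection m p) N^-1 * Y i s = 0.
  rewrite /Y; under eq_bigr do rewrite mulrA mulrCA.
  by rewrite -mulr_suml -mulr_sumr mean_centered_hits mulr0 mul0r.
have YV : \sum_i \sum_(s : injection m p) N^-1 * Y i s ^+ 2 <=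
    (p%:R / m%:R - 1) * maxrow_norm X ^+ 2.
  under eq_bigr do under eq_bigr do rewrite YE mulrCA.
  under eq_bigr do rewrite -mulr_sumr variance_centered_hits.
  by rewrite -mulr_suml mulrC ler_wpM2l ?subr_ge0// sum_row_le_maxrow.
have w0 (s : injection m p) : 0 <= N^-1 by [].
have := bernstein_product_weight w0 sum_weight Y0 YM YV
  (mulr_ge0 tau0 X0) (mulr_gt0 n0 t0).
rewrite (eq_bigl _ _ (fun s => ltr_pdivlMl _ _ n0)) => /le_trans; apply.
rewrite le_eqVlt; apply/orP; left; apply/eqP.
(* Dividing numerator and denominator of Bernstein's exponent by [n] gives the exponent of
   [delta1]. *)
set V := _ * maxrow_norm X ^+ 2; set M := tau R m p * mx_norm X.
have -> : V + M * (n%:R * t) / 3 = n%:R * (V / n%:R + M * t / 3).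
  by field; rewrite gt_eqF.
have -> : - (n%:R * t ^+ 2) / 2 = - ((n%:R * t) ^+ 2 / 2) / n%:R.
  by field; rewrite gt_eqF.
by rewrite invfM [in LHS]mulrA.
Qed.

(** A union bound over the [p] coordinates and the two signs produces the factor [2 * p].
    Bernstein's bound is available for [0 < t]; at [t = 0] the value of [delta1] is [2 * p], which
    exceeds the total weight 1. *)
Lemma tail_bound n (X : 'M[R]_(p, n)) (t : R) : (0 < n)%N -> 0 <= t ->
  \sum_(s : {ffun 'I_n -> injection m p} |
      [exists j, t < `|n%:R^-1 * \sum_i centered_hits j (s i) * X j i|])
    \prod_(i < n) N^-1 <= delta1 m X t.
Proof.
move=> n_gt0; rewrite le_eqVlt => /predU1P[<-|t0].
  rewrite /delta1 expr0n/= mulr0 oppr0 !mul0r expR0 mulr1.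
  apply: (@le_trans _ _ 1).
    rewrite -[leRHS](sum_product_weight n) [leRHS](bigID
      (fun s : {ffun 'I_n -> injection m p} => [exists j, 0 < `|n%:R^-1 * \sum_i centered_hits j (s i) * X j i|]))/=.
    by rewrite lerDl sumr_ge0// => s _; exact: prodr_ge0.
  by rewrite -natrM ler1n muln_gt0/= (leq_trans m_gt0).
pose Q (s : {ffun 'I_n -> injection m p}) j e :=
  t < n%:R^-1 * \sum_i (-1) ^+ e * centered_hits j (s i) * X j i.
pose W : R := \prod_(i < n) N^-1.
have W0 : 0 <= W by rewrite prodr_ge0.
(* A sample in the event satisfies [Q s j e] for some [j] and [e], so the double sum counts its
   weight at least once. *)
apply: (@le_trans _ _ (\sum_(s : {ffun 'I_n -> injection m p})
    \sum_(j < p) \sum_(e : bool) if Q s j e then W else 0)).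
  rewrite big_mkcond; apply: ler_sum => s _; rewrite -/W.
  have S0 j : 0 <= \sum_(e : bool) if Q s j e then W else 0.
    by apply: sumr_ge0 => e _; case: ifP.
  case: ifPn => [/existsP[j tj]|_]; last by rewrite sumr_ge0.
  rewrite (bigD1 j)//= -[leLHS]addr0 lerD ?sumr_ge0// big_bool/=.
  have QE e : Q s j e =
      (t < (-1) ^+ e * (n%:R^-1 * \sum_i centered_hits j (s i) * X j i)).
    by rewrite /Q; under eq_bigr do rewrite -mulrA; rewrite -mulr_sumr mulrCA.
  rewrite !QE expr1 expr0 mulN1r mul1r.
  move: tj; rewrite ltr_normr => /orP[|] ->; case: ifP => _;
    by rewrite ?lerDl ?lerDr ?addr0 ?add0r.
rewrite exchange_big/= /delta1; set B := expR _.
rewrite mulrAC mulr_natr -[X in _ *+ X]card_ord -sumr_const.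
apply: ler_sum => j _; rewrite exchange_big/= mulr_natl -card_bool -sumr_const.
apply: ler_sum => e _; rewrite -big_mkcond/=.
exact: coordinate_tail.
Qed.

End uniform_injection.

(** * Probability and expectation over finitely many disjoint events *)

Section finite_partition.
Context d (T : measurableType d) (R : realType) (P : probability T R).
Variables (O : finType) (A : O -> set T).
Hypotheses (mA : forall o, measurable (A o)) (tA : trivIset setT A).

Lemma probability_bigsetU (s : seq O) : uniq s ->
  P (\big[setU/set0]_(o <- s) A o) = (\sum_(o <- s) P (A o))%E.
Proof.
move=> us; rewrite -bigcup_seq.
rewrite measure_fin_bigcup//; last exact: sub_trivIset tA.
by rewrite (fsbig_seq _ _ us).
Qed.

Lemma probability_ge_sum_blocks (Q : pred O) (F : set T) : measurable F ->
  (forall o, Q o -> A o `<=` F) -> (\sum_(o | Q o) P (A o) <= P F)%E.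
Proof.
move=> mF AF.
rewrite -big_filter -probability_bigsetU ?filter_uniq ?index_enum_uniq//.
apply: le_measure; rewrite ?inE//; first exact: bigsetU_measurable.
rewrite -bigcup_seq => w [i /=]; rewrite mem_filter => /andP[Qo _].
exact: AF.
Qed.

Hypothesis A1 : (\sum_o P (A o) = 1)%E.

(** The blocks have total mass 1, so [f] agrees almost everywhere with its restriction to their
    union, on which it is constant block by block. *)
Lemma expectation_blocks (f : T -> R) (c : O -> R) : measurable_fun setT f ->
  (forall o w, A o w -> f w = c o) ->
  ('E_P[f] = \sum_o (c o)%:E * P (A o))%E.
Proof.
move=> mf fc; pose D := \big[setU/set0]_(o <- index_enum O) A o.
have mD : measurable D by apply: bigsetU_measurable.
have tA' : trivIset [set` index_enum O] A by exact: sub_trivIset tA.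
have PD : P (~` D) = 0%E.
  by rewrite probability_setC// probability_bigsetU ?index_enum_uniq// A1 subee.
rewrite unlock.
transitivity (\int[P]_w ((EFin \o f) \_ D) w)%E.
  apply: ae_eq_integral => //.
  - exact/measurable_EFinP.
  - apply/(measurable_restrictT _ mD).
    by apply: measurable_funTS; exact/measurable_EFinP.
  - exists (~` D); split => //; first exact: measurableC.
    move=> w /= h Dw; apply: h => _.
    by rewrite patchE mem_set.
rewrite -integral_mkcond integral_bigsetU_EFin//.
- by apply: eq_bigr => o _; rewrite (eq_integral (cst (c o)%:E)) ?integral_cst//
    => w /set_mem Aw; rewrite (fc o).
- exact: index_enum_uniq.
- by apply: measurable_funTS; exact/measurable_EFinP.
Qed.

End finite_partition.

(** * Measurability in the space of matrices *)

Lemma measurable_entry (R : realType) (p m : nat) (j : 'I_p) (k : 'I_m) :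
  measurable_fun setT (fun A : borelMx R p m => (A : 'M[R]_(p, m)) j k).
Proof.
move=> _ B mB; rewrite setTI; apply: sub_sigma_algebra.
by exists (j, k) => //; exists B => //; rewrite setTI.
Qed.

(** A point is a finite intersection of preimages of points under the entry maps. *)
Lemma measurable_set1_borelMx (R : realType) (p m : nat) (M : borelMx R p m) :
  measurable [set M].
Proof.
rewrite [X in measurable X](_ : _ = \bigcap_(jk in [set: 'I_p * 'I_m])
  ((fun A : borelMx R p m => (A : 'M[R]_(p, m)) jk.1 jk.2) @^-1`
    [set (M : 'M[R]_(p, m)) jk.1 jk.2])).
  apply: fin_bigcap_measurable => // jk _.
  by rewrite -[X in measurable X]setTI; exact: measurable_entry.
apply/seteqP; split => [A -> jk _ //|A AM].
by apply/matrixP => j k; exact: (AM (j, k)).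
Qed.

(** * Reduction of the estimator to finite sums over samples *)

Section estimator.
Variables (R : realType) (p m n : nat) (X : 'M[R]_(p, n)).

Lemma estimator_error_sampling (s : 'I_n -> injection m p) (j : 'I_p) :
  (sample_mean_estimator X (fun i => sampling_mx R (val (s i))) - sample_mean X)
    j 0 = n%:R^-1 * \sum_i centered_hits R j (s i) * X j i.
Proof.
rewrite !mxE !summxE mulrCA -mulrBr mulr_sumr -sumrB; congr (_ * _).
apply: eq_bigr => i _; rewrite mul_sampling_mx_col mxE /centered_hits.
by rewrite mulrBl mul1r mulrA.
Qed.

(** Exchanging the sums over samples and over [i] reduces each term to a single marginal, which is
    centered. *)
Lemma mean_estimator_error (m_gt0 : (0 < m)%N) (m_le_p : (m <= p)%N)
    (j : 'I_p) :
  \sum_(s : {ffun 'I_n -> injection m p})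
    (\prod_(i < n) #|{: injection m p}|%:R^-1) *
    (n%:R^-1 * \sum_i centered_hits R j (s i) * X j i) = 0.
Proof.
under eq_bigr do rewrite mulrCA mulr_sumr.
rewrite -mulr_sumr exchange_big/= big1 ?mulr0// => i _.
under eq_bigr do rewrite mulrA.
rewrite -mulr_suml (product_weight_marginal (sum_weight R m_le_p)).
by rewrite mean_centered_hits ?mul0r.
Qed.

Context d (T : measurableType d) (P : probability T R).
Variable S : 'I_n -> {RV P >-> borelMx R p m}.

Lemma measurable_estimator_error (j : 'I_p) :
  measurable_fun setT (fun w =>
    (sample_mean_estimator X (fun i => S i w) - sample_mean X) j 0).
Proof.
have mS i j' k : measurable_fun setT (fun w => (S i w : 'M[R]_(p, m)) j' k).
  exact: (measurableT_comp (measurable_entry j' k) (measurable_funPT (S i))).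
under eq_fun do rewrite !mxE summxE.
apply: measurable_funB => //; apply: measurable_funM => //.
apply: measurable_funM => //; apply: measurable_sum => i.
under eq_fun do rewrite !mxE.
apply: measurable_sum => l; apply: measurable_funM => //.
under eq_fun do rewrite !mxE.
apply: measurable_sum => k; apply: measurable_funM => //.
by under eq_fun do rewrite mxE; exact: mS.
Qed.

(** The maximum defining [mx_norm] starts from 0; [0 <= t] covers that base value. *)
Lemma mx_norm_le_colP (A : 'cV[R]_p) (t : R) : 0 <= t ->
  (mx_norm A <= t) = [forall j, `|A j 0| <= t].
Proof.
move=> t0; rewrite mx_normrE; apply/idP/forallP => [/bigmax_leP[_ At] j|At].
  exact: (At (j, 0)).
by apply: bigmax_le => // -[j k] _/=; rewrite (ord1 k).
Qed.

(** The blocks on which the estimator is constant; the uniform law and independence give them total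
    mass 1. *)
Definition sample_event (s : {ffun 'I_n -> injection m p}) : set T :=
  \bigcap_(i in [set: 'I_n]) (S i @^-1` [set sampling_mx R (val (s i))]).

Lemma measurable_sample_event s : measurable (sample_event s).
Proof.
apply: fin_bigcap_measurable => // i _; rewrite -[X in measurable X]setTI.
apply: measurable_funPT => //; exact: measurable_set1_borelMx.
Qed.

Lemma trivIset_sample_event : trivIset setT sample_event.
Proof.
apply/trivIsetP => s s' _ _; apply: contra_neqP => /eqP/set0P[w [ws ws']].
apply/ffunP => i; apply/val_inj/(@sampling_mx_inj R).
by rewrite -(ws i I) -(ws' i I).
Qed.

Hypotheses (hunif : forall i, uniform_sampling (S i))
  (hindep : mutually_independent S).

(** Independence over the full index set factors the probability, and each factor is the uniform
    mass of one injection. *)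
Lemma probability_sample_event s :
  P (sample_event s) = (\prod_(i < n) #|{: injection m p}|%:R^-1)%:E.
Proof.
have mB i : measurable ([set sampling_mx R (val (s i))] : set (borelMx R p m)).
  exact: measurable_set1_borelMx.
have := hindep [set: 'I_n]%SET mB.
rewrite (_ : \bigcap_(i in _) _ = sample_event s); last first.
  rewrite /sample_event (_ : [set` _] = setT)//.
  by apply/seteqP; split => i //= _; rewrite /= inE.
move=> ->; rewrite (eq_bigl xpredT) => [|i]; last by rewrite inE.
rewrite -prodEFin; apply: eq_bigr => i _.
by rewrite hunif ?card_sig//; exact: (injectiveP _ (valP (s i))).
Qed.

End estimator.

Theorem theorem4 (R : realType) (p m n : nat)
    (hm : (1 <= m)%N) (hmp : (m <= p)%N) (hn : (1 <= n)%N)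
    (X : 'M[R]_(p, n))
    (d : measure_display) (T : measurableType d) (P : probability T R)
    (S : 'I_n -> {RV P >-> borelMx R p m})
    (hunif : forall i, uniform_sampling (S i))
    (hindep : mutually_independent S) :
  (forall j : 'I_p,
     'E_P[(fun w => sample_mean_estimator X (fun i => S i w) j 0)%R]%E
     = (sample_mean X j 0)%:E) /\
  (forall t : R, 0 <= t ->
     ((1 - delta1 m X t)%:E <=
      P [set w | (mx_norm (sample_mean_estimator X (fun i => S i w)
                           - sample_mean X) <= t)%R])%E).
Proof.
pose W : R := \prod_(i < n) #|{: injection m p}|%:R^-1.
have PA s : P (sample_event S s) = W%:E by exact: probability_sample_event.
have W1 : \sum_(s : {ffun 'I_n -> injection m p}) W = 1.
  exact: sum_product_weight.
pose err w := sample_mean_estimator X (fun i => S i w) - sample_mean X.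
have errE s w (j : 'I_p) : sample_event S s w ->
    err w j 0 = n%:R^-1 * \sum_i centered_hits R j (s i) * X j i.
  move=> sw; rewrite -estimator_error_sampling /err.
  congr ((sample_mean_estimator X _ - _) _ _).
  by apply/funext => i; rewrite (sw i I).
have mA := measurable_sample_event S.
have tA := @trivIset_sample_event _ _ _ _ _ _ _ S.
split=> [j|t t0].
  (* The estimator is written as error plus constant, because measurability and block values are
     established for the error. *)
  have -> : (fun w => sample_mean_estimator X (fun i => S i w) j 0) =
      (fun w => err w j 0 + sample_mean X j 0).
    apply/funext => w; rewrite -[sample_mean_estimator _ _](subrK (sample_mean X)).
    by rewrite mxE.
  rewrite (expectation_blocks mA tA _ (c := fun s =>
    n%:R^-1 * \sum_i centered_hits R j (s i) * X j i + sample_mean X j 0)).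
  - under eq_bigr do rewrite PA -EFinM mulrC mulrDr.
    by rewrite sumEFin big_split/= mean_estimator_error// add0r -mulr_suml W1 mul1r.
  - by under eq_bigr do rewrite PA; rewrite sumEFin W1.
  - by apply: measurable_funD => //; exact: measurable_estimator_error.
  - by move=> s w sw; rewrite (errE s).
pose good (s : {ffun 'I_n -> injection m p}) :=
  [forall j, `|n%:R^-1 * \sum_i centered_hits R j (s i) * X j i| <= t].
(* Only the blocks of good samples are kept: their mass is 1 minus that of the bad ones, which
   [tail_bound] bounds by [delta1]. *)
apply: (@le_trans _ _ (\sum_(s | good s) P (sample_event S s))%E).
  under eq_bigr do rewrite PA.
  rewrite sumEFin lee_fin lerBlDr -W1 [leLHS](bigID good)/= lerD2l.
  apply: le_trans (tail_bound hm hmp X hn t0).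
  rewrite le_eqVlt; apply/orP; left; apply/eqP; apply: eq_bigl => s.
  by rewrite negb_forall; apply: eq_existsb => j; rewrite -ltNge.
apply: (probability_ge_sum_blocks P mA tA (Q := good)) => [|s /forallP good_s w sw /=].
  rewrite [X in measurable X](_ : _ =
      \bigcap_(j in [set: 'I_p]) [set w | `|err w j 0| <= t]).
    apply: fin_bigcap_measurable => // j _.
    rewrite -[X in measurable X]setTI; apply: measurable_fun_le => //.
    by apply: measurableT_comp => //; exact: measurable_estimator_error.
  apply/seteqP; split=> w /=; rewrite mx_norm_le_colP//.
    by move=> /forallP + j _; exact.
  by move=> h; apply/forallP => j; exact: h.
by rewrite mx_norm_le_colP//; apply/forallP => j; rewrite -/(err w) (errE s).
Qed.
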